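(* Let $L=O$ be an order of $K$. For all $m_0\ge1$, $B\ge1$ and $\delta_0>0$, the set $$S(m_0,B,\delta_0):=\{s=(u_1,u_2,u_3)\ \text{admissible sorted triple of elements of }L:\ m(s)\le m_0,\ |N(u_i)|\le B\ (i=1,2,3),\ \delta(s)=\delta_0\}$$ is finite modulo $\langle\eta\rangle$, with the explicit bound $$\#\bigl(S(m_0,B,\delta_0)/\langle\eta\rangle\bigr)\le\bigl(2C_L\max(X_0,(B/x_* )^{1/2})+1\bigr)^9,$$ where $$X_0=\sqrt3\,B^{1/3}e^{\mathrm{Reg}_O},\qquad x_*=\min\Bigl(1,\bigl[(3B)^{1/2}+(m_0\delta_0)^{1/2}\bigr]^{-2}\Bigr),$$ and $\mathrm{Reg}_O$, $C_L$ and $\eta$ are as defined in the context.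
   Context: $K$ is a cubic number field of signature $(1,1)$, with real embedding $\sigma_r$, complex embedding $\sigma_c$ and field norm $N$; $O\subseteq\mathcal O_K$ is an order and $L=O$. A triple $s=(u_1,u_2,u_3)$ of elements of $L$ is admissible if $x_i=\sigma_r(u_i)>0$ for all $i$, and sorted if $x_1\ge x_2\ge x_3$. Put $\xi=(x_1,x_2,x_3)$, $\hat\xi=\xi/|\xi|$, $(\sigma_c(u_1),\sigma_c(u_2),\sigma_c(u_3))=a+ib$ with $a,b\in\mathbb R^3$, and $\delta(s)=2|\det(\xi,a,b)|=|\mathrm{disc}(u_1,u_2,u_3)|^{1/2}$. With $a_\perp=a-\langle a,\hat\xi\rangle\hat\xi$, $b_\perp=b-\langle b,\hat\xi\rangle\hat\xi$, the conformal module is $m(s)=(|a_\perp|^2+|b_\perp|^2)/(2|a_\perp\times b_\perp|)$ (defined when $\delta(s)\ne0$). Let $\varepsilon$ be a fundamental unit of $K$ and $\eta$ the smallest power of $\pm\varepsilon$ lying in $O^\times$ with $\sigma_r(\eta)>0$, normalized (replacing $\eta$ by $\eta^{-1}$ if necessary) so that $\sigma_r(\eta)>1$; put $\mathrm{Reg}_O:=\log\sigma_r(\eta)>0$. The group $\langle\eta\rangle$ acts by $s\mapsto\eta^ks=(\eta^ku_1,\eta^ku_2,\eta^ku_3)$. Let $(\omega_1,\omega_2,\omega_3)$ be a $\mathbb Z$-basis of $L$, $W=(\sigma_j(\omega_k))_{j,k}$ its embedding matrix (rows indexed by the three embeddings $\sigma_r,\sigma_c,\overline{\sigma_c}$, columns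 by $k$), and $C_L:=\max_k\sum_j|(W^{-1})_{kj}|$. *)

(* Defs.v *)
From HB Require Import structures.
From mathcomp Require Import all_boot all_order all_algebra all_field.
From mathcomp Require Import finmap.
From mathcomp Require Import all_classical all_reals all_analysis.
From mathcomp Require Import complex.

Set Implicit Arguments.
Unset Strict Implicit.
Unset Printing Implicit Defensive.

Import Order.TTheory GRing.Theory Num.Theory.

Local Open Scope classical_set_scope.
Local Open Scope ring_scope.
Local Open Scope complex_scope.

(* For a cubic field these two clauses say that the signature is (1,1): sr is
   the only real embedding, and the non-real complex embeddings are exactly sc
   and its conjugate. *)
Definition signature_1_1 (R : realType) (K : fieldExtType rat)
    (sr : {rmorphism K -> R}) (sc : {rmorphism K -> R[i]}) : Prop :=
  (forall t : {rmorphism K -> R}, t =1 sr) /\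
  ((exists x, complex.Im (sc x) != 0) /\
   forall t : {rmorphism K -> R[i]}, (exists x, complex.Im (t x) != 0) ->
     t =1 sc \/ forall x, t x = conjc (sc x)).

Definition field_norm (K : fieldExtType rat) (x : K) : rat :=
  \det (passmx.mxof (vbasis {:K}) (vbasis {:K}) (amulr x)).

Definition ring_of_integers (K : fieldExtType rat) : set K :=
  [set x | integralOver (intr : int -> K) x].

Definition is_Zbasis (K : fieldExtType rat) (n : nat) (w : 'rV[K]_n)
    (O : set K) : Prop :=
  (forall x, O x <-> exists c : 'I_n -> int, x = \sum_i w 0 i *~ c i) /\
  (forall c : 'I_n -> int, \sum_i w 0 i *~ c i = 0 -> forall i, c i = 0).

Definition is_order (K : fieldExtType rat) (O : set K) : Prop :=
  [/\ O 1 /\ (forall x y, O x -> O y -> O (x - y) /\ O (x * y)),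
      O `<=` @ring_of_integers K
    & exists w : 'rV[K]_(\dim {:K}), is_Zbasis w O].

(* The condition x != 0 is needed because 0^-1 = 0. *)
Definition units_of (K : fieldExtType rat) (O : set K) : set K :=
  [set x | [/\ x != 0, O x & O x^-1]].

(* e is a basis of the unit group of the maximal order modulo torsion. *)
Definition is_fundamental_unit (K : fieldExtType rat) (e : K) : Prop :=
  [/\ units_of (@ring_of_integers K) e,
      forall n : nat, e ^+ n = 1 -> n = 0%N
    & forall u, units_of (@ring_of_integers K) u ->
        exists (z : K) (k : nat) (n : int),
          [/\ (0 < k)%N, z ^+ k = 1 & u = z * e ^ n]].

Definition positive_unit_power (R : realType) (K : fieldExtType rat)
    (sr : {rmorphism K -> R}) (O : set K) (e : K) (n : nat) (y : K) : Prop :=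
  [/\ (0 < n)%N, y = e ^+ n \/ y = (- e) ^+ n, units_of O y & 0 < sr y].

Definition is_normalized_unit (R : realType) (K : fieldExtType rat)
    (sr : {rmorphism K -> R}) (O : set K) (e eta : K) : Prop :=
  exists (n : nat) (y : K),
    [/\ positive_unit_power sr O e n y,
        forall m z, positive_unit_power sr O e m z -> (n <= m)%N,
        eta = y \/ eta = y^-1
      & 1 < sr eta].

Definition regulator (R : realType) (K : fieldExtType rat)
    (sr : {rmorphism K -> R}) (eta : K) : R := ln (sr eta).

Definition dot (R : realType) (v w : 'rV[R]_3) : R := \sum_i v 0 i * w 0 i.

(* The canonical norm of 'rV[R]_3 is the sup norm, hence this one. *)
Definition enorm (R : realType) (v : 'rV[R]_3) : R := Num.sqrt (dot v v).

(* Indices are computed in 'I_3, that is, modulo 3. *)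
Definition cross (R : realType) (v w : 'rV[R]_3) : 'rV[R]_3 :=
  \row_i (v 0 (i + 1) * w 0 (i + 2) - v 0 (i + 2) * w 0 (i + 1)).

Definition perp (R : realType) (xi v : 'rV[R]_3) : 'rV[R]_3 :=
  let xihat := (enorm xi)^-1 *: xi in v - dot v xihat *: xihat.

Definition re_vec (R : realType) (K : fieldExtType rat)
    (sc : {rmorphism K -> R[i]}) (s : 'rV[K]_3) : 'rV[R]_3 :=
  \row_i complex.Re (sc (s 0 i)).

Definition im_vec (R : realType) (K : fieldExtType rat)
    (sc : {rmorphism K -> R[i]}) (s : 'rV[K]_3) : 'rV[R]_3 :=
  \row_i complex.Im (sc (s 0 i)).

Definition delta (R : realType) (K : fieldExtType rat)
    (sr : {rmorphism K -> R}) (sc : {rmorphism K -> R[i]})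
    (s : 'rV[K]_3) : R :=
  2 * `|\det (\matrix_(i < 3) [:: map_mx sr s; re_vec sc s; im_vec sc s]`_i)|.

(* Only meaningful when delta sr sc s != 0, which ensures that the denominator
   does not vanish. *)
Definition conformal_module (R : realType) (K : fieldExtType rat)
    (sr : {rmorphism K -> R}) (sc : {rmorphism K -> R[i]})
    (s : 'rV[K]_3) : R :=
  let xi := map_mx sr s in
  let a' := perp xi (re_vec sc s) in
  let b' := perp xi (im_vec sc s) in
  (enorm a' ^+ 2 + enorm b' ^+ 2) / (2 * enorm (cross a' b')).

Definition admissible (R : realType) (K : fieldExtType rat)
    (sr : {rmorphism K -> R}) (L : set K) (s : 'rV[K]_3) : Prop :=
  forall i, L (s 0 i) /\ 0 < sr (s 0 i).

Definition sorted_triple (R : realType) (K : fieldExtType rat)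
    (sr : {rmorphism K -> R}) (s : 'rV[K]_3) : Prop :=
  sr (s 0 0) >= sr (s 0 1) /\ sr (s 0 1) >= sr (s 0 2).

Definition bounded_triples (R : realType) (K : fieldExtType rat)
    (sr : {rmorphism K -> R}) (sc : {rmorphism K -> R[i]}) (L : set K)
    (m0 B delta0 : R) : set 'rV[K]_3 :=
  [set s | [/\ admissible sr L s, sorted_triple sr s,
               conformal_module sr sc s <= m0,
               forall i, `|ratr (field_norm (s 0 i))| <= B
             & delta sr sc s = delta0]].

Definition orbit_of (K : fieldExtType rat) (eta : K) (s : 'rV[K]_3) :
    set 'rV[K]_3 :=
  [set eta ^ k *: s | k in [set: int]].

Definition orbits (K : fieldExtType rat) (eta : K) (S : set 'rV[K]_3) :
    set (set 'rV[K]_3) :=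
  [set orbit_of eta s | s in S].

Definition embedding_matrix (R : realType) (K : fieldExtType rat)
    (sr : {rmorphism K -> R}) (sc : {rmorphism K -> R[i]})
    (w : 'rV[K]_3) : 'M[R[i]]_3 :=
  \matrix_(j < 3, k < 3)
    [:: (sr (w 0 k))%:C; sc (w 0 k); conjc (sc (w 0 k))]`_j.

Definition C_const (R : realType) (K : fieldExtType rat)
    (sr : {rmorphism K -> R}) (sc : {rmorphism K -> R[i]})
    (w : 'rV[K]_3) : R :=
  \big[Num.max/0]_(k < 3)
    \sum_(j < 3) Normc.normc (invmx (embedding_matrix sr sc w) k j).

(* Main.v *)
Require Import Defs.
From HB Require Import structures.
From mathcomp Require Import all_boot all_order all_algebra all_field.
From mathcomp Require Import finmap.
From mathcomp Require Import all_classical all_reals all_analysis.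
From mathcomp Require Import complex.
From mathcomp Require Import ring lra zify.
Import Order.TTheory GRing.Theory Num.Theory.
Import Normc.
Set Implicit Arguments.
Unset Strict Implicit.
Unset Printing Implicit Defensive.
Local Open Scope classical_set_scope.
Local Open Scope ring_scope.

(** The theorem holds because every orbit meets the finite set of triples in O
    all of whose conjugates are at most M = max (X0, sqrt (B / xstar)).

    Write x_i for the real and z_i for the complex conjugate of u_i, so that
    |N(u_i)| = x_i |z_i|^2, and write xi = (x_1, x_2, x_3), r = |xi| and
    D = sqrt (3B) + sqrt (m0 delta0).  The key point is a lower bound for the
    smallest coordinate x_3, relative to r.  As 2 |a' x b'| r = delta, where a'
    and b' are the components of a and b orthogonal to xi, the bound on the
    conformal module says r (|a'|^2 + |b'|^2) <= m0 delta0
    ([perp_le_conformal]).  The rest of z = a + ib is its projection on xi,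
    whose last coordinate is (sum_i x_i z_i) x_3 / r^2; it is small because
    x_i |z_i| <= sqrt (B x_i) and x_3 <= r / sqrt 3.  Altogether
    r |z_3|^2 <= D^2 ([enorm_mul_last_le]).  Since u_3 is a nonzero algebraic
    integer, 1 <= x_3 |z_3|^2, and therefore x_1 <= r <= x_3 D^2
    ([real_embedding_lower_bound]).

    This inequality is homogeneous in the x_i.  Multiplying the triple by a
    power of eta preserves the norms and lets x_1 be moved into [1, sigma_r(eta)[
    ([normalizing_exponent]).  Then all x_i lie between D^-2 and X0, hence
    |z_i|^2 <= B / x_i <= B / xstar.  Inverting the embedding matrix W turns the
    bound M on the conjugates into the bound C_L M on the nine integer
    coordinates ([coord_le_C_const]), and there are at most 2 C_L M + 1 choices
    for each of them ([card_int_matrices_le]).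

    Both facts on norms, namely that x |z|^2 is the absolute value of the field
    norm and that it is at least 1 on nonzero elements of O, come from one
    observation: the embedding matrix of a basis intertwines the matrix of the
    multiplication by u with the diagonal matrix of the conjugates of u, so
    their determinants agree ([abs_norm_mul_matrix]).  W is invertible
    as a left factor of the embedding matrix of any triple with delta <> 0, whose
    determinant is delta up to a factor of modulus 1 ([embedding_matrix_unit]). *)

(** * Vectors of dimension three *)

Lemma det_mx33 (R : comRingType) (M : 'M[R]_3) :
  \det M = M 0 0 * (M 1 1 * M 2 2 - M 1 2 * M 2 1)
         - M 0 1 * (M 1 0 * M 2 2 - M 1 2 * M 2 0)
         + M 0 2 * (M 1 0 * M 2 1 - M 1 1 * M 2 0).
Proof.
(* Indexing by natural numbers lets the minors be computed by reduction. *)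
pose f a b := M (inord a) (inord b).
have fE i j : M i j = f i j by rewrite /f !inord_val.
rewrite (expand_det_row _ 0) !big_ord_recl big_ord0 /cofactor.
rewrite !(expand_det_row _ 0) !big_ord_recl !big_ord0 /cofactor !det_mx11 !mxE.
rewrite !fE /= /bump /=.
by ring.
Qed.

Lemma sum_ord3 (V : nmodType) (f : 'I_3 -> V) : \sum_i f i = f 0 + f 1 + f 2.
Proof.
rewrite !big_ord_recl big_ord0 addr0 addrA.
by congr (_ + f _ + f _); apply/val_inj.
Qed.

Lemma dotE (R : realType) (v w : 'rV[R]_3) :
  dot v w = v 0 0 * w 0 0 + v 0 1 * w 0 1 + v 0 2 * w 0 2.
Proof. exact: sum_ord3. Qed.

Lemma enorm_ge0 (R : realType) (v : 'rV[R]_3) : 0 <= enorm v.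
Proof. exact: sqrtr_ge0. Qed.

Lemma dot_ge0 (R : realType) (v : 'rV[R]_3) : 0 <= dot v v.
Proof. by apply: sumr_ge0 => i _; rewrite -expr2 sqr_ge0. Qed.

Lemma enorm_sqr (R : realType) (v : 'rV[R]_3) : enorm v ^+ 2 = dot v v.
Proof. by rewrite sqr_sqrtr ?dot_ge0. Qed.

Lemma ler_entry_enorm (R : realType) (v : 'rV[R]_3) i : `|v 0 i| <= enorm v.
Proof.
rewrite -(@ler_pXn2r _ 2) ?nnegrE ?enorm_ge0// enorm_sqr real_normK ?num_real//.
rewrite /dot (bigD1 i)//= -expr2 lerDl sumr_ge0// => j _.
by rewrite -expr2 sqr_ge0.
Qed.

Lemma perpE (R : realType) (xi v : 'rV[R]_3) i :
  perp xi v 0 i = v 0 i - dot v xi / enorm xi ^+ 2 * xi 0 i.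
Proof.
rewrite /perp !mxE !dotE !mxE -exprVn; ring.
Qed.

Lemma crossE (R : realType) (v w : 'rV[R]_3) :
  [/\ cross v w 0 0 = v 0 1 * w 0 2 - v 0 2 * w 0 1,
      cross v w 0 1 = v 0 2 * w 0 0 - v 0 0 * w 0 2
    & cross v w 0 2 = v 0 0 * w 0 1 - v 0 1 * w 0 0].
Proof.
by rewrite /cross !mxE; split; congr (v 0 _ * w 0 _ - v 0 _ * w 0 _);
  apply/val_inj.
Qed.

(** Subtracting multiples of xi from a and b does not change det (xi, a, b), and
    for p and q orthogonal to xi the cross product of p and q is parallel to xi,
    so that |xi| |p x q| is the full determinant. *)
Lemma enorm_cross_perp (R : realType) (xi a b : 'rV[R]_3) :
  enorm xi != 0 ->
  enorm xi * enorm (cross (perp xi a) (perp xi b)) =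
  `|\det (\matrix_(i < 3) [:: xi; a; b]`_i)|.
Proof.
move=> xi0.
apply/eqP; rewrite -(@eqrXn2 _ 2) ?mulr_ge0 ?enorm_ge0 ?normr_ge0//.
rewrite exprMn real_normK ?num_real// !enorm_sqr det_mx33 !mxE /=.
rewrite !dotE.
have [-> -> ->] := crossE (perp xi a) (perp xi b).
have r0 : xi 0 0 * xi 0 0 + xi 0 1 * xi 0 1 + xi 0 2 * xi 0 2 != 0.
  by rewrite -dotE -enorm_sqr expf_neq0.
rewrite !perpE !enorm_sqr !dotE.
move: r0; move: (xi 0 0) (xi 0 1) (xi 0 2) (a 0 0) (a 0 1) (a 0 2) 
  (b 0 0) (b 0 1) (b 0 2) => x y z a0 a1 a2 b0 b1 b2 r0.
set r := _ + _ in r0 *.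
set s := _ / r; set t := _ / r.
have P0 : (a0 - s * x) * x + (a1 - s * y) * y + (a2 - s * z) * z = 0.
  rewrite -[LHS]/(_ + _) /s /r; field. exact: r0.
have Q0 : (b0 - t * x) * x + (b1 - t * y) * y + (b2 - t * z) * z = 0.
  rewrite -[LHS]/(_ + _) /t /r; field. exact: r0.
have lagrange (p0 p1 p2 q0 q1 q2 : R) :
    p0 * x + p1 * y + p2 * z = 0 -> q0 * x + q1 * y + q2 * z = 0 ->
    r * ((p1 * q2 - p2 * q1) * (p1 * q2 - p2 * q1)
       + (p2 * q0 - p0 * q2) * (p2 * q0 - p0 * q2)
       + (p0 * q1 - p1 * q0) * (p0 * q1 - p1 * q0)) =
    (x * (p1 * q2 - p2 * q1) - y * (p0 * q2 - p2 * q0)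
      + z * (p0 * q1 - p1 * q0)) ^+ 2.
  set P := _ + p2 * z => p0E; set Q := _ + q2 * z => q0E.
  (* Lagrange's identity for xi and p x q, where xi x (p x q) = Q p - P q. *)
  transitivity ((x * (p1 * q2 - p2 * q1) - y * (p0 * q2 - p2 * q0)
      + z * (p0 * q1 - p1 * q0)) ^+ 2 + (p0 * Q - q0 * P) ^+ 2
      + (p1 * Q - q1 * P) ^+ 2 + (p2 * Q - q2 * P) ^+ 2).
    by rewrite /P /Q /r; ring.
  by rewrite p0E q0E; ring.
rewrite (lagrange _ _ _ _ _ _ P0 Q0); apply/eqP; congr (_ ^+ 2).
by move: s t {P0 Q0} => s t; ring.
Qed.

(** * The modulus of complex numbers *)

Lemma normc_ge0 (R : rcfType) (z : R[i]) : 0 <= normc z.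
Proof. by case: z => a b; apply: sqrtr_ge0. Qed.

Lemma normc_sqr (R : rcfType) (z : R[i]) :
  normc z ^+ 2 = complex.Re z ^+ 2 + complex.Im z ^+ 2.
Proof. by case: z => a b; rewrite sqr_sqrtr ?addr_ge0 ?sqr_ge0. Qed.

Lemma normc_real (R : rcfType) (x : R) : normc (x%:C)%C = `|x|.
Proof. by rewrite /normc /= expr0n addr0 sqrtr_sqr. Qed.

Lemma normc_conj (R : rcfType) (z : R[i]) : normc (conjc z) = normc z.
Proof. by case: z => a b; rewrite /= sqrrN. Qed.

Lemma normc_sum (R : rcfType) (I : Type) (r : seq I) (f : I -> R[i]) :
  normc (\sum_(i <- r) f i) <= \sum_(i <- r) normc (f i).
Proof.
elim: r => [|i r IHr]; first by rewrite !big_nil normc0.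
by rewrite !big_cons (le_trans (le_normcD _ _))// lerD2l.
Qed.

(** * The smallest coordinate of a triple of bounded conformal module *)

(** The quotient in the conformal module has denominator 2d / |xi|, by
    [enorm_cross_perp]. *)
Lemma perp_le_conformal (R : realType) (xi a b : 'rV[R]_3) (m0 : R) :
  let d := `|\det (\matrix_(i < 3) [:: xi; a; b]`_i)| in
  let p := perp xi a in let q := perp xi b in
  0 < enorm xi -> 0 < d ->
  (enorm p ^+ 2 + enorm q ^+ 2) / (2 * enorm (cross p q)) <= m0 ->
  enorm xi * (enorm p ^+ 2 + enorm q ^+ 2) <= m0 * (2 * d).
Proof.
move=> d p q xi0 d0.
have dE : enorm xi * enorm (cross p q) = d.
  by rewrite enorm_cross_perp ?gt_eqF.
have c0 : 0 < enorm (cross p q) by rewrite -(pmulr_rgt0 _ xi0) dE.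
rewrite ler_pdivrMr ?mulr_gt0// => /(ler_wpM2l (ltW xi0)) /le_trans; apply.
rewrite -dE le_eqVlt; apply/orP; left; apply/eqP; ring.
Qed.

(** The vector z = a + ib is split into its part w orthogonal to xi, controlled by
    D, and its projection on xi.  The last coordinate of the projection carries
    the factor xi_2 / |xi|^2, and the smallest of three coordinates is at most
    |xi| / sqrt 3: this is what turns the three terms sqrt B into sqrt (3B). *)
Lemma enorm_mul_last_le (R : realType) (xi a b : 'rV[R]_3) (B D : R) :
  (forall i, 0 < xi 0 i) -> (forall i, xi 0 2 <= xi 0 i) ->
  (forall i, xi 0 i * (a 0 i ^+ 2 + b 0 i ^+ 2) <= B) ->
  enorm xi * (enorm (perp xi a) ^+ 2 + enorm (perp xi b) ^+ 2) <= D ->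
  enorm xi * (a 0 2 ^+ 2 + b 0 2 ^+ 2) <= (Num.sqrt (3 * B) + Num.sqrt D) ^+ 2.
Proof.
move=> xi_gt0 xi_min normB perpD.
pose z i := (a 0 i +i* b 0 i)%C; set r := enorm xi.
have xi_le i : xi 0 i <= r.
  by rewrite (le_trans _ (ler_entry_enorm xi i)) ?ler_norm.
have r_gt0 : 0 < r := lt_le_trans (xi_gt0 0) (xi_le 0).
have B_ge0 : 0 <= B.
  by apply: le_trans (normB 0); rewrite mulr_ge0 ?addr_ge0 ?sqr_ge0// (ltW (xi_gt0 _)).
have last_le : Num.sqrt 3 * xi 0 2 <= r.
  rewrite -(@ler_pXn2r _ 2) ?nnegrE ?mulr_ge0 ?sqrtr_ge0 ?(ltW (xi_gt0 _)) ?(ltW r_gt0)//.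
  rewrite exprMn sqr_sqrtr// enorm_sqr dotE -!expr2.
  have sq_le i : xi 0 2 ^+ 2 <= xi 0 i ^+ 2.
    by rewrite ler_sqr ?nnegrE ?(ltW (xi_gt0 _)).
  by have := sq_le 0; have := sq_le 1; lra.
pose w := (perp xi a 0 2 +i* perp xi b 0 2)%C.
pose S := \sum_i z i * ((xi 0 i)%:C)%C.
have zE : z 2 = w + S * ((xi 0 2 / r ^+ 2)%:C)%C.
  rewrite /S sum_ord3 /z /w !perpE !dotE -/r /=; simpc; apply/eqP.
  by rewrite eq_complex /=; apply/andP; split; apply/eqP; ring.
have w_le : Num.sqrt r * normc w <= Num.sqrt D.
  rewrite -ler_sqr ?nnegrE ?mulr_ge0 ?sqrtr_ge0 ?normc_ge0//.
  have sq_le v : perp xi v 0 2 ^+ 2 <= enorm (perp xi v) ^+ 2.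
    by rewrite -real_normK ?num_real// ler_pXn2r ?nnegrE ?enorm_ge0// ler_entry_enorm.
  have h : r * (perp xi a 0 2 ^+ 2 + perp xi b 0 2 ^+ 2) <= D.
    by apply: le_trans perpD; rewrite ler_pM2l// lerD.
  rewrite exprMn normc_sqr /= sqr_sqrtr ?(ltW r_gt0)// sqr_sqrtr//.
  by apply: le_trans h; rewrite mulr_ge0 ?(ltW r_gt0)// addr_ge0 ?sqr_ge0.
have S_le : normc S <= 3 * (Num.sqrt B * Num.sqrt r).
  apply: le_trans (normc_sum _ _) _.
  have term i : normc (z i * ((xi 0 i)%:C)%C) <= Num.sqrt B * Num.sqrt r.
    rewrite normcM normc_real gtr0_norm//.
    rewrite -ler_sqr ?nnegrE ?mulr_ge0 ?sqrtr_ge0 ?normc_ge0 ?(ltW (xi_gt0 _))//.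
    rewrite !exprMn normc_sqr /= !sqr_sqrtr ?(ltW r_gt0)//.
    rewrite mulrC expr2 mulrAC ler_pM ?(ltW (xi_gt0 _))//.
    by rewrite mulr_ge0 ?(ltW (xi_gt0 _))// addr_ge0 ?sqr_ge0.
  by rewrite sum_ord3; have := term 0; have := term 1; have := term 2; lra.
rewrite -(@sqr_sqrtr _ r) ?(ltW r_gt0)// -[_ + _]/(complex.Re (z 2) ^+ 2 + complex.Im (z 2) ^+ 2).
rewrite -normc_sqr -exprMn ler_pXn2r ?nnegrE ?mulr_ge0 ?addr_ge0 ?sqrtr_ge0 ?normc_ge0//.
rewrite zE [leRHS]addrC; apply: le_trans (ler_wpM2l (sqrtr_ge0 _) (le_normcD _ _)) _.
have c_ge0 : 0 <= xi 0 2 / r ^+ 2 by rewrite divr_ge0 ?exprn_ge0 ?ltW.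
rewrite mulrDr lerD// normcM normc_real ger0_norm//.
have -> : Num.sqrt (3 * B) = Num.sqrt 3 * Num.sqrt B by rewrite sqrtrM.
apply: le_trans (ler_wpM2l (sqrtr_ge0 _) (ler_wpM2r c_ge0 S_le)) _.
have -> : Num.sqrt r * (3 * (Num.sqrt B * Num.sqrt r) * (xi 0 2 / r ^+ 2)) =
    Num.sqrt 3 * Num.sqrt B * (Num.sqrt 3 * xi 0 2 / r).
  have s3 : Num.sqrt 3 ^+ 2 = 3 :> R by rewrite sqr_sqrtr.
  have sr : r = Num.sqrt r ^+ 2 by rewrite sqr_sqrtr ?ltW.
  have t0 : 0 < Num.sqrt r by rewrite sqrtr_gt0.
  have {t0} : Num.sqrt r != 0 by rewrite gt_eqF.
  move: sr s3; move: (Num.sqrt r) (Num.sqrt 3) => t u -> <- t0; field; exact: t0.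
by rewrite ler_piMr ?mulr_ge0 ?sqrtr_ge0// ler_pdivrMr// mul1r.
Qed.

(** * Conjugates, norms and integer coordinates *)

(** Indexed like the rows of the embedding matrix. *)
Definition embed (R : realType) (K : fieldExtType rat) (sr : {rmorphism K -> R})
    (sc : {rmorphism K -> R[i]}) (j : 'I_3) : {rmorphism K -> R[i]} :=
  match val j with
  | 0%N => real_complex R \o sr
  | 1%N => sc
  | _ => @conjc R \o sc
  end.

(** The absolute value of the norm of x, in terms of its conjugates. *)
Definition abs_norm (R : realType) (K : fieldExtType rat)
    (sr : {rmorphism K -> R}) (sc : {rmorphism K -> R[i]}) (x : K) : R :=
  `|sr x| * normc (sc x) ^+ 2.

Lemma embedding_matrixE (R : realType) (K : fieldExtType rat)
    (sr : {rmorphism K -> R}) (sc : {rmorphism K -> R[i]}) (w : 'rV[K]_3) j k :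
  embedding_matrix sr sc w j k = embed sr sc j (w 0 k).
Proof. by rewrite mxE; case: j => -[|[|[|?]]]. Qed.

Lemma abs_normE (R : realType) (K : fieldExtType rat)
    (sr : {rmorphism K -> R}) (sc : {rmorphism K -> R[i]}) (x : K) :
  abs_norm sr sc x = normc (\prod_j embed sr sc j x).
Proof.
rewrite !big_ord_recl big_ord0 mulr1 /embed /= !normcM normc_real normc_conj.
by rewrite -expr2.
Qed.

Lemma abs_normM (R : realType) (K : fieldExtType rat)
    (sr : {rmorphism K -> R}) (sc : {rmorphism K -> R[i]}) (x y : K) :
  abs_norm sr sc (x * y) = abs_norm sr sc x * abs_norm sr sc y.
Proof. by rewrite /abs_norm !rmorphM normrM normcM exprMn mulrACA. Qed.

(** The dimension n stays a variable because it is instantiated with the dimension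
    of the field, which equals 3 only propositionally.  The factor C expresses
    that E is invertible without mentioning an inverse of a matrix whose two
    dimensions are different terms. *)
Lemma det_intertwined (F : fieldType) (n : nat) (D : 'M[F]_3)
    (E : 'M[F]_(3, n)) (C : 'M[F]_(n, 3)) (A : 'M[F]_n) : n = 3%N ->
  E *m C \in unitmx -> D *m E = E *m A -> \det A = \det D.
Proof.
move=> n3; move: E C A; rewrite n3 => E C A; rewrite unitmx_mul => /andP[uE _].
move=> /(congr1 determinant); rewrite !det_mulmx mulrC => /mulfI -> //.
by rewrite -unitfE.
Qed.

(** A is the matrix of the multiplication by x in the family b; its eigenvalues are
    the conjugates of x, with the rows of the embedding matrix of b as
    eigenvectors. *)
Lemma abs_norm_mul_matrix (R : realType) (K : fieldExtType rat)
    (sr : {rmorphism K -> R}) (sc : {rmorphism K -> R[i]}) (n : nat)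
    (b : 'I_n -> K) (C : 'M[R[i]]_(n, 3)) (A : 'M[R[i]]_n) (x : K) : n = 3%N ->
  (\matrix_(j, k) embed sr sc j (b k)) *m C \in unitmx ->
  (forall j k, embed sr sc j (x * b k) = \sum_l A k l * embed sr sc j (b l)) ->
  normc (\det A) = abs_norm sr sc x.
Proof.
move=> n3 uEC hA; rewrite abs_normE -det_tr.
rewrite (det_intertwined (D := diag_mx (\row_j embed sr sc j x)) n3 uEC).
  by rewrite det_diag; congr normc; apply: eq_bigr => j _; rewrite mxE.
apply/matrixP => j k; rewrite mul_diag_mx !mxE -rmorphM hA.
by apply: eq_bigr => l _; rewrite !mxE mulrC.
Qed.

(** Instance of [abs_norm_mul_matrix] for the rational basis that defines the
    field norm.  The triple s certifies that the embedding matrix of this basis is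
    invertible. *)
Lemma abs_field_norm (R : realType) (K : fieldExtType rat)
    (sr : {rmorphism K -> R}) (sc : {rmorphism K -> R[i]}) (s : 'rV[K]_3) (x : K) :
  \dim {:K} = 3%N -> embedding_matrix sr sc s \in unitmx ->
  `|ratr (field_norm x)| = abs_norm sr sc x.
Proof.
move=> hK us; set b := vbasis {:K}.
have bP : basis_of {:K} b := vbasisP _.
have embed_coord j v :
    embed sr sc j v = \sum_l ratr (coord b l v) * embed sr sc j b`_l.
  rewrite [in LHS](coord_basis bP (memvf v)) rmorph_sum; apply: eq_bigr => l _.
  by rewrite -mulr_algl rmorphM alg_num_field fmorph_rat.
rewrite -normc_real -[RHS](@abs_norm_mul_matrix _ _ _ _ _ (fun k => b`_k)
    (\matrix_(k, l) ratr (coord b k (s 0 l)))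
    (map_mx ratr (passmx.mxof b b (amulr x))))//.
- rewrite det_map_mx; congr normc.
  exact: (fmorph_rat (real_complex R)).
- suff <- : embedding_matrix sr sc s = (\matrix_(j, k) embed sr sc j b`_k) *m
      (\matrix_(k, l) ratr (coord b k (s 0 l))) by [].
  apply/matrixP => j l; rewrite embedding_matrixE embed_coord !mxE.
  by apply: eq_bigr => k _; rewrite !mxE mulrC.
- move=> j k; rewrite embed_coord; apply: eq_bigr => l _; rewrite mxE; congr (ratr _ * _).
  by rewrite !mxE /= passmx.vecof_delta lfunE /= mulrC.
Qed.

Lemma embedding_matrix_unit (R : realType) (K : fieldExtType rat)
    (sr : {rmorphism K -> R}) (sc : {rmorphism K -> R[i]}) (s : 'rV[K]_3) :
  delta sr sc s != 0 -> embedding_matrix sr sc s \in unitmx.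
Proof.
rewrite /delta mulf_eq0 normr_eq0 negb_or => /andP[_].
set M := (\matrix_(i < 3) _) => detM.
(* The rows of P take (x, z, conj z) to x, Re z and Im z. *)
pose rows : seq (seq R[i]) := [:: [:: 1; 0; 0];
  [:: 0; (2^-1)%:C; (2^-1)%:C]; [:: 0; 0 -i* 2^-1; 0 +i* 2^-1]]%C.
pose P : 'M[R[i]]_3 := \matrix_(i < 3, j < 3) nth 0 (nth [::] rows i) j.
have MP : map_mx (real_complex R) M = P *m embedding_matrix sr sc s.
  apply/matrixP => i j; rewrite !mxE sum_ord3 !mxE.
  case: i => -[|[|[|//]]] ? /=; rewrite ?mxE /=.
  - by rewrite mul1r !mul0r !addr0.
  - case: (sc (s 0 j)) => a b /=; simpc; apply/eqP; rewrite eq_complex /=.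
    by apply/andP; split; apply/eqP; field.
  - case: (sc (s 0 j)) => a b /=; simpc; apply/eqP; rewrite eq_complex /=.
    by apply/andP; split; apply/eqP; field.
suff : \det (embedding_matrix sr sc s) != 0 by rewrite unitmxE unitfE.
apply: contraNneq detM => d0; rewrite -(fmorph_eq0 (real_complex R)).
by rewrite -det_map_mx MP det_mulmx d0 mulr0.
Qed.

Lemma integral_coords (K : fieldExtType rat) (n : nat) (O : set K)
    (omega : 'rV[K]_n) (m : nat) (s : 'I_m -> K) :
  is_Zbasis omega O -> (forall i, O (s i)) ->
  exists c : 'M[int]_(n, m), forall i, s i = \sum_k omega 0 k *~ c k i.
Proof.
move=> [hO _] Os; have h i := (hO (s i)).1 (Os i).
exists (\matrix_(k, i) sval (cid (h i)) k) => i; rewrite [LHS](svalP (cid (h i))).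
by apply: eq_bigr => k _; rewrite mxE.
Qed.

Lemma embedding_matrix_coords (R : realType) (K : fieldExtType rat)
    (sr : {rmorphism K -> R}) (sc : {rmorphism K -> R[i]}) (omega s : 'rV[K]_3)
    (c : 'M[int]_3) :
  (forall i, s 0 i = \sum_k omega 0 k *~ c k i) ->
  embedding_matrix sr sc s = embedding_matrix sr sc omega *m map_mx intr c.
Proof.
move=> sE; apply/matrixP => j i; rewrite embedding_matrixE sE rmorph_sum mxE.
by apply: eq_bigr => k _; rewrite embedding_matrixE rmorphMz mxE mulrzr.
Qed.

(** The coordinates of s are W^-1 applied to its conjugates, and C_const is the
    operator norm of W^-1 for the maximum norms. *)
Lemma coord_le_C_const (R : realType) (K : fieldExtType rat)
    (sr : {rmorphism K -> R}) (sc : {rmorphism K -> R[i]}) (omega s : 'rV[K]_3)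
    (c : 'M[int]_3) (M : R) : 0 <= M ->
  embedding_matrix sr sc omega \in unitmx ->
  (forall i, s 0 i = \sum_k omega 0 k *~ c k i) ->
  (forall j i, normc (embed sr sc j (s 0 i)) <= M) ->
  forall k i, `|c k i|%:~R <= C_const sr sc omega * M.
Proof.
move=> M_ge0 uW sE sM k i.
have cE : map_mx intr c = invmx (embedding_matrix sr sc omega) *m
    embedding_matrix sr sc s.
  by rewrite (embedding_matrix_coords _ _ sE) mulKmx.
have -> : `|c k i|%:~R = normc ((map_mx intr c : 'M[R[i]]_3) k i).
  by rewrite mxE -(rmorph_int (real_complex R)) normc_real intr_norm.
rewrite cE mxE; apply: le_trans (normc_sum _ _) _.
apply: (@le_trans _ _ (\sum_j normc (invmx (embedding_matrix sr sc omega) k j) * M)).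
  by apply: ler_sum => j _; rewrite normcM embedding_matrixE ler_wpM2l ?normc_ge0.
rewrite -mulr_suml ler_wpM2r//.
exact: (le_bigmax _ (fun k => \sum_(j < 3)
  normc (invmx (embedding_matrix sr sc omega) k j))).
Qed.

Lemma C_const_ge0 (R : realType) (K : fieldExtType rat)
    (sr : {rmorphism K -> R}) (sc : {rmorphism K -> R[i]}) (omega : 'rV[K]_3) :
  0 <= C_const sr sc omega.
Proof. exact: bigmax_ge_id. Qed.

(** In a Z-basis of O the multiplication by x has an integer matrix, so abs_norm x
    is the absolute value of an integer; it is nonzero because embeddings are
    injective. *)
Lemma abs_norm_ge1 (R : realType) (K : fieldExtType rat)
    (sr : {rmorphism K -> R}) (sc : {rmorphism K -> R[i]}) (O : set K)
    (omega : 'rV[K]_3) (x : K) :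
  is_order O -> is_Zbasis omega O -> embedding_matrix sr sc omega \in unitmx ->
  O x -> x != 0 -> 1 <= abs_norm sr sc x.
Proof.
move=> [[_ hO] _ _] hom uW Ox x0.
have Oom k : O (omega 0 k).
  apply/(hom.1 _); exists (fun l => (l == k)%:R); rewrite (bigD1 k)//= eqxx.
  by rewrite big1 ?addr0// => l /negPf ->; rewrite mulr0z.
have [c cE] := integral_coords hom (fun k => (hO _ _ Ox (Oom k)).2).
have absE : normc (\det (map_mx intr c^T)) = abs_norm sr sc x.
  apply: (@abs_norm_mul_matrix _ _ _ _ _ (fun k => omega 0 k) 1%:M) => //.
    rewrite mulmx1; apply: etrans uW; congr (_ \in unitmx).
    by apply/matrixP => j k; rewrite embedding_matrixE mxE.
  move=> j k; rewrite cE rmorph_sum; apply: eq_bigr => l _.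
  by rewrite rmorphMz !mxE mulrzl.
have abs_gt0 : 0 < abs_norm sr sc x.
  rewrite mulr_gt0 ?normr_gt0 ?fmorph_eq0// exprn_gt0// lt_neqAle normc_ge0 andbT.
  by rewrite eq_sym; apply: contra x0 => /eqP/eq0_normc/eqP; rewrite fmorph_eq0.
move: abs_gt0; rewrite -absE det_map_mx /= -(rmorph_int (real_complex R)) normc_real.
by rewrite -intr_norm ltr0z ler1z.
Qed.

Lemma units_of_exp (K : fieldExtType rat) (O : set K) (u : K) (k : int) :
  is_order O -> units_of O u -> units_of O (u ^ k).
Proof.
move=> [[one_in hO] _ _] [u0 Ou Ou'].
have powO v n : O v -> O (v ^+ n).
  by move=> Ov; elim: n => [|n IHn]; rewrite ?expr0// exprS; apply: (hO _ _ Ov IHn).2.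
have powzO (l : int) : O (u ^ l).
  by case: l => n; rewrite ?NegzE -?exprnN -?exprVn; apply: powO.
by split; rewrite ?expfz_neq0// invr_expz.
Qed.

(** The norms of u and of its inverse are both at least 1, and their product is
    1. *)
Lemma abs_norm_unit (R : realType) (K : fieldExtType rat)
    (sr : {rmorphism K -> R}) (sc : {rmorphism K -> R[i]}) (O : set K)
    (omega : 'rV[K]_3) (u : K) :
  is_order O -> is_Zbasis omega O -> embedding_matrix sr sc omega \in unitmx ->
  units_of O u -> abs_norm sr sc u = 1.
Proof.
move=> hO hom uW [u0 Ou Ou'].
have ge1 v : O v -> v != 0 -> 1 <= abs_norm sr sc v by move=> Ov v0; apply: (abs_norm_ge1 hO hom uW Ov v0).
have n1 : abs_norm sr sc u * abs_norm sr sc u^-1 = 1.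
  by rewrite -abs_normM mulfV// /abs_norm !rmorph1 normr1 normc1 expr1n mulr1.
have u_ge1 := ge1 _ Ou u0.
have v_ge1 : 1 <= abs_norm sr sc u^-1 by rewrite ge1// invr_eq0.
apply/eqP; rewrite eq_le u_ge1 andbT -[leRHS]n1 ler_peMr//.
exact: le_trans u_ge1.
Qed.

Lemma normalizing_exponent (R : realType) (rho x : R) : 1 < rho -> 0 < x ->
  exists k : int, 1 <= rho ^ k * x < rho.
Proof.
move=> rho1 x0; have rho0 : 0 < rho by apply: lt_trans rho1.
have lr0 : 0 < ln rho by rewrite ln_gt0.
have powE (k : int) : rho ^ k = expR (k%:~R * ln rho).
  by rewrite -powR_intmul ?ltW// /powR gt_eqF.
exists (- Num.floor (ln x / ln rho)).
have xE : x = expR (ln x) by rewrite lnK.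
rewrite [X in _ * X]xE powE -expRD -[X in _ < X](lnK (rho0 : rho \is Num.pos)) -[X in X <= _]expR0 ler_expR ltr_expR.
have := floor_le (ln x / ln rho); have := floorD1_gt (ln x / ln rho).
rewrite ler_pdivlMr// ltr_pdivrMr// mulrzDr mulrNz mulr1z.
move: (ln x) (ln rho) ((Num.floor _)%:~R) => a b c *; apply/andP; split; lra.
Qed.

(** * Counting integer matrices *)

(** With N the integer part of Y, an integer c with |c| <= Y is coded by c + N,
    which is one of the 2N + 1 <= 2Y + 1 numbers 0, ..., 2N. *)
Lemma card_int_matrices_le (R : realType) (T : choiceType) (m n : nat)
    (f : 'M[int]_(m, n) -> T) (Q : set T) (Y : R) : 0 <= Y ->
  (forall q, Q q -> exists2 c : 'M[int]_(m, n),
     forall i j, `|c i j|%:~R <= Y & q = f c) ->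
  finite_set Q /\ (#|` fset_set Q|)%:R <= (2 * Y + 1) ^+ (m * n).
Proof.
move=> Y_ge0 hQ; pose N := Num.truncn Y.
pose dec (A : 'M['I_(2 * N).+1]_(m, n)) : 'M[int]_(m, n) :=
  \matrix_(i, j) ((A i j : nat)%:Z - N%:Z).
have Qdec q : Q q -> exists A, q = f (dec A).
  move=> /hQ[c cY ->]; exists (\matrix_(i, j) inord (absz (c i j + N%:Z))).
  congr f; apply/matrixP => i j; rewrite !mxE.
  have cN : (absz (c i j) <= N)%N.
    by rewrite truncn_ge_nat// natr_absz.
  rewrite inordK; last by lia.
  by rewrite gez0_abs; lia.
have Qsub : Q `<=` (f \o dec) @` [set: 'M['I_(2 * N).+1]_(m, n)].
  by move=> q /Qdec[A ->]; exists A.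
have Qfin : finite_set Q by apply: sub_finite_set Qsub _; apply: finite_image.
split => //.
have Qfset : (fset_set Q `<=` [fset f (dec A) | A in predT])%fset.
  apply/fsubsetP => q; rewrite in_fset_set// inE => /Qdec[A ->].
  by apply/imfsetP; exists A.
have cardQ : (#|` fset_set Q| <= (2 * N).+1 ^ (m * n))%N.
  apply: leq_trans (fsubset_leq_card Qfset) _.
  apply: leq_trans (leq_imfset_card _ _ _) _.
  rewrite -[X in (_ <= X ^ _)%N]card_ord -card_mx cardT.
  by apply: uniq_leq_size (enum_finmem_uniq _) _ => A _; rewrite mem_enum.
apply: (@le_trans _ _ (((2 * N).+1 ^ (m * n))%N%:R)); first by rewrite ler_nat.
rewrite natrX lerXn2r ?nnegrE//; first lra.
by rewrite -natr1 natrM lerD2r ler_pM2l// truncn_le.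
Qed.

(** * Bounded triples up to units *)

Lemma last_le_sorted (R : realType) (K : fieldExtType rat)
    (sr : {rmorphism K -> R}) (s : 'rV[K]_3) :
  sorted_triple sr s -> forall i, sr (s 0 2) <= sr (s 0 i) <= sr (s 0 0).
Proof.
move=> [s01 s12] i; have s02 := le_trans s12 s01.
have [->|[->|->]] : i = 0 \/ i = 1 \/ i = 2.
- by case: i => -[|[|[|//]]] ?; [left|right; left|right; right]; apply/val_inj.
- by rewrite s02 lexx.
- by rewrite s12 s01.
- by rewrite s02 lexx.
Qed.

(** Both sides have the same degree in the real conjugates, so this remains usable
    after multiplication of s by any power of a unit. *)
Lemma real_embedding_lower_bound (R : realType) (K : fieldExtType rat)
    (sr : {rmorphism K -> R}) (sc : {rmorphism K -> R[i]}) (s : 'rV[K]_3)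
    (m0 B delta0 : R) :
  0 < delta0 -> (forall i, 0 < sr (s 0 i)) -> sorted_triple sr s ->
  conformal_module sr sc s <= m0 -> delta sr sc s = delta0 ->
  (forall i, 1 <= abs_norm sr sc (s 0 i) <= B) ->
  sr (s 0 0) <= sr (s 0 2) * (Num.sqrt (3 * B) + Num.sqrt (m0 * delta0)) ^+ 2.
Proof.
move=> d_gt0 s_gt0 s_sorted s_m s_d s_N.
set xi := map_mx sr s; set a := re_vec sc s; set b := im_vec sc s.
have xiE i : xi 0 i = sr (s 0 i) by rewrite mxE.
have NE i : sr (s 0 i) * (a 0 i ^+ 2 + b 0 i ^+ 2) = abs_norm sr sc (s 0 i).
  by rewrite !mxE /abs_norm normc_sqr gtr0_norm.
have x0_le : sr (s 0 0) <= enorm xi.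
  by rewrite -xiE (le_trans (ler_norm _))// ler_entry_enorm.
have xi_gt0 : 0 < enorm xi := lt_le_trans (s_gt0 0) x0_le.
have det_gt0 : 0 < `|\det (\matrix_(i < 3) [:: xi; a; b]`_i)|.
  by rewrite -(@pmulr_rgt0 _ 2)// -[_ * _]/(delta sr sc s) s_d.
have perpD := perp_le_conformal xi_gt0 det_gt0 s_m.
rewrite -[2 * _]/(delta sr sc s) s_d in perpD.
have last : enorm xi * (a 0 2 ^+ 2 + b 0 2 ^+ 2) <=
    (Num.sqrt (3 * B) + Num.sqrt (m0 * delta0)) ^+ 2.
  apply: enorm_mul_last_le perpD => i; rewrite !xiE //.
  - by case/andP: (last_le_sorted s_sorted i).
  - by rewrite NE; case/andP: (s_N i).
apply: le_trans x0_le _; apply: le_trans (ler_wpM2l (ltW (s_gt0 2)) last).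
rewrite mulrCA NE ler_peMr ?enorm_ge0//; by case/andP: (s_N 2).
Qed.

Theorem theorem5p1 (R : realType) (K : fieldExtType rat)
  (hK : \dim {:K} = 3%N)
  (sr : {rmorphism K -> R}) (sc : {rmorphism K -> R[i]})
  (hsig : signature_1_1 sr sc)
  (O : set K) (hO : is_order O)
  (eps : K) (heps : is_fundamental_unit eps)
  (eta : K) (heta : is_normalized_unit sr O eps eta)
  (omega : 'rV[K]_3) (homega : is_Zbasis omega O)
  (m0 B delta0 : R) (hm0 : 1 <= m0) (hB : 1 <= B) (hdelta0 : 0 < delta0) :
  let Q := orbits eta (bounded_triples sr sc O m0 B delta0) in
  let X0 := Num.sqrt 3 * B `^ (3^-1) * expR (regulator sr eta) in
  let xstar :=
    Num.min 1 ((Num.sqrt (3 * B) + Num.sqrt (m0 * delta0)) ^- 2) in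
  finite_set Q /\
  (#|` fset_set Q|)%:R <=
    (2 * C_const sr sc omega * Num.max X0 (Num.sqrt (B / xstar)) + 1) ^+ 9.
Proof.
move=> Q X0 xstar.
set D := Num.sqrt (3 * B) + Num.sqrt (m0 * delta0) in xstar *.
set M := Num.max X0 _.
have [eta_unit eta_gt1] : units_of O eta /\ 1 < sr eta.
  case: heta => n [y [[_ _ [y0 Oy Oy'] _] _ etaE ?]]; split=> //.
  by case: etaE => ->; split; rewrite ?invr_eq0 ?invrK.
set rho := sr eta in eta_gt1.
have rho_gt0 : 0 < rho by apply: lt_trans eta_gt1.
have rho_le : rho <= X0.
  rewrite /X0 /regulator lnK// ler_peMl ?(ltW rho_gt0)//.
  rewrite mulr_ege1//; first by rewrite -[leLHS]sqrtr1 ler_sqrt ?ler1n.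
  by rewrite -[leLHS](powRr0 B) ler_powR ?invr_ge0.
have D_gt0 : 0 < D.
  by rewrite ltr_wpDr ?sqrtr_ge0// sqrtr_gt0 mulr_gt0// (lt_le_trans ltr01).
have xstar_gt0 : 0 < xstar by rewrite lt_min ltr01 invr_gt0 exprn_gt0.
have M_ge0 : 0 <= M by rewrite le_max (le_trans (ltW rho_gt0) rho_le).
rewrite -mulrA; apply: (@card_int_matrices_le _ _ 3 3
  (fun c => orbit_of eta (\row_i \sum_k omega 0 k *~ c k i))).
  by rewrite mulr_ge0 ?C_const_ge0.
move=> _ [s [s_adm s_sorted s_m s_N s_d] <-].
have s_gt0 i : 0 < sr (s 0 i) := (s_adm i).2.
have s_neq0 i : s 0 i != 0 by rewrite -(fmorph_eq0 sr) gt_eqF.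
have us : embedding_matrix sr sc s \in unitmx.
  by apply: embedding_matrix_unit; rewrite s_d gt_eqF.
have [cs csE] := integral_coords homega (fun i => (s_adm i).1).
have uW : embedding_matrix sr sc omega \in unitmx.
  by move: us; rewrite (embedding_matrix_coords _ _ csE) unitmx_mul => /andP[].
have s_N1 i : 1 <= abs_norm sr sc (s 0 i) <= B.
  by rewrite (abs_norm_ge1 hO homega uW (s_adm i).1)//= -(abs_field_norm _ hK us).
have last := real_embedding_lower_bound hdelta0 s_gt0 s_sorted s_m s_d s_N1.
have [k /andP[k_ge1 k_lt]] := normalizing_exponent eta_gt1 (s_gt0 0).
have uk : units_of O (eta ^ k) by apply: units_of_exp.
(* t is the representative of the orbit of s with 1 <= sr (t 0 0) < rho. *)
pose t := eta ^ k *: s.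
have tE i : t 0 i = eta ^ k * s 0 i by rewrite mxE.
have Ot i : O (t 0 i).
  by rewrite tE; case: hO => [[_ hO'] _ _]; apply: (hO' _ _ _ (s_adm i).1).2; case: uk.
have orbitE : orbit_of eta s = orbit_of eta t.
  have eta0 : eta != 0 by case: eta_unit.
  apply/seteqP; split => _ [l _ <-].
    by exists (l - k) => //; rewrite scalerA -expfzDr// subrK.
  by exists (l + k) => //; rewrite scalerA -expfzDr.
have srt i : sr (t 0 i) = rho ^ k * sr (s 0 i) by rewrite tE rmorphM fmorphXz.
have rhok_gt0 : 0 < rho ^ k by rewrite exprz_gt0.
have t_gt0 i : 0 < sr (t 0 i) by rewrite srt mulr_gt0.
have t_le i : sr (t 0 i) <= rho.
  rewrite srt (le_trans _ (ltW k_lt))// ler_pM2l//.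
  by case/andP: (last_le_sorted s_sorted i).
have t_ge i : xstar <= sr (t 0 i).
  apply: (@le_trans _ _ (D ^- 2)); first by rewrite ge_min lexx orbT.
  rewrite -[leLHS]mul1r ler_pdivrMr ?exprn_gt0// (le_trans k_ge1)//.
  rewrite srt -mulrA ler_pM2l// (le_trans last)// ler_pM2r ?exprn_gt0//.
  by case/andP: (last_le_sorted s_sorted i).
have t_N i : abs_norm sr sc (t 0 i) <= B.
  rewrite tE abs_normM (abs_norm_unit hO homega uW uk) mul1r.
  by case/andP: (s_N1 i).
have sct i : normc (sc (t 0 i)) <= Num.sqrt (B / xstar).
  have B_ge0 : 0 <= B := le_trans ler01 hB.
  rewrite -ler_sqr ?nnegrE ?normc_ge0 ?sqrtr_ge0// sqr_sqrtr ?divr_ge0 ?(ltW xstar_gt0)//.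
  rewrite ler_pdivlMr// (le_trans _ (t_N i))// /abs_norm gtr0_norm// mulrC.
  by rewrite ler_wpM2r ?exprn_ge0 ?normc_ge0.
have t_M j i : normc (embed sr sc j (t 0 i)) <= M.
  rewrite /M le_max; case: j => -[|[|[|//]]] ?; rewrite /embed /=.
  - by rewrite expr0n addr0 sqrtr_sqr gtr0_norm// (le_trans (t_le i)).
  - by rewrite sct orbT.
  - by rewrite (normc_conj (sc (t 0 i))) sct orbT.
have [c cE] := integral_coords homega Ot.
exists c; first exact: (coord_le_C_const M_ge0 uW cE t_M).
by rewrite orbitE; congr orbit_of; apply/rowP => i; rewrite [RHS]mxE cE.
Qed.
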